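(* For any relation $(R,X,Y)$, the maps $|\pi_R|:|E(R)|\to|D(R)|$ and $|\widehat{\pi}_R|:|E(R)|\to|D(R^T)|$ induced on geometric realizations by the coordinate projections are homotopy equivalences. Moreover, for any morphism of relations $f=(f_1,f_2):(R_0,X_0,Y_0)\to(R_1,X_1,Y_1)$, the following diagram of simplicial complexes and simplicial maps commutes: $$\begin{array}{ccccc} D(R_0) & \xleftarrow{\ \pi_{R_0}\ } & E(R_0) & \xrightarrow{\ \widehat{\pi}_{R_0}\ } & D(R_0^T)\\ {\scriptstyle D(f)}\downarrow & & {\scriptstyle E(f)}\downarrow & & \downarrow{\scriptstyle D(f^T)}\\ D(R_1) & \xleftarrow{\ \pi_{R_1}\ } & E(R_1) & \xrightarrow{\ \widehat{\pi}_{R_1}\ } & D(R_1^T) \end{array}$$ that is, $D(f)\circ\pi_{R_0}=\pi_{R_1}\circ E(f)$ and $D(f^T)\circ\widehat{\pi}_{R_0}=\widehat{\pi}_{R_1}\circ E(f)$.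
   Context: A relation is a triple of sets $(R,X,Y)$ with $R\subseteq X\times Y$; no finiteness is assumed on $X$, $Y$ or $R$. A morphism of relations $f:(R_0,X_0,Y_0)\to(R_1,X_1,Y_1)$ is a pair of functions $f=(f_1:X_0\to X_1,\ f_2:Y_0\to Y_1)$ such that $(x,y)\in R_0$ implies $(f_1(x),f_2(y))\in R_1$. The transpose relation of $(R,X,Y)$ is $(R^T,Y,X)$, where $(y,x)\in R^T$ if and only if $(x,y)\in R$. For a morphism of relations $f=(f_1,f_2):(R_0,X_0,Y_0)\to(R_1,X_1,Y_1)$, $f^T=(f_2,f_1):(R_0^T,Y_0,X_0)\to(R_1^T,Y_1,X_1)$. A simplicial complex is a pair $(K,V)$ consisting of a vertex set $V$ and a set $K$ of non-empty finite subsets of $V$ (the simplices) such that every non-empty subset of an element of $K$ is in $K$. It is not required that $\{v\}\in K$ for every $v\in V$. A simplicial map $F:(K,V)\to(K',V')$ is a function $F:V\to V'$ such that $\sigma\in K$ implies $F(\sigma)=\{F(s)\mid s\in\sigma\}\in K'$; composition is composition of functions. The geometric realization of $(K,V)$ is denoted $|K|$; it is the usual one, with the topology coherent with its closed simplices. A simplicial map $F$ induces a continuous map $|F|:|K|\to|K'|$. Elements $v\in V$ with $\{v\}\notin K$ contribute no points to $|K|$. The Dowker complex of $(R,X,Y)$ is the simplicial complex with vertex set $X$ and simplices $$D(R)=\{\sigma\subseteq X \text{ finite, non-empty}\mid \exists\, y\in Y \text{ with } \sigma\times\{y\}\subseteq R\}.$$ In particular $D(R^T)$ has vertex set $Y$.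 A morphism $f=(f_1,f_2)$ induces the simplicial map $D(f):D(R_0)\to D(R_1)$ given on vertices by $f_1:X_0\to X_1$; thus $D(f^T):D(R_0^T)\to D(R_1^T)$ is given on vertices by $f_2:Y_0\to Y_1$. Let $\pi_R:R\to X$, $(x,y)\mapsto x$, and $\widehat{\pi}_R:R\to Y$, $(x,y)\mapsto y$, be the coordinate projections. The rectangle complex of $(R,X,Y)$ is the simplicial complex with vertex set $R$ and simplices $$E(R)=\{\tau\subseteq R\text{ finite, non-empty}\mid \pi_R(\tau)\times\widehat{\pi}_R(\tau)\subseteq R\},$$ that is, the finite non-empty subsets of $R$ contained in a finite subset of $R$ of the form $U\times V$ with $U\subseteq X$, $V\subseteq Y$. A morphism $f=(f_1,f_2)$ induces the simplicial map $E(f):E(R_0)\to E(R_1)$ given on vertices by $(x,y)\mapsto(f_1(x),f_2(y))$. The coordinate projections define simplicial maps $\pi_R:E(R)\to D(R)$ and $\widehat{\pi}_R:E(R)\to D(R^T)$. *)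

(* Defs.v *)
(* The real line is an arbitrary [F : realType] of MathComp-Analysis, [R] being
   kept for relations. *)
From HB Require Import structures.
From mathcomp Require Import all_boot all_order all_algebra.
From mathcomp Require Import all_classical all_reals all_analysis.

Set Implicit Arguments.
Unset Strict Implicit.
Unset Printing Implicit Defensive.

Import Order.TTheory GRing.Theory Num.Theory.
Import numFieldNormedType.Exports.

Local Open Scope classical_set_scope.
Local Open Scope ring_scope.

(* The singleton of a vertex need not be a simplex. *)
Record scomplex (V : Type) := SComplex {
  simplices : set (set V);
  simplex_finite : forall s, simplices s -> finite_set s;
  simplex_neq0 : forall s, simplices s -> s !=set0;
  simplex_sub : forall s t, simplices s -> t !=set0 -> t `<=` s -> simplices t
}.

Record smap (V W : Type) (K : scomplex V) (L : scomplex W) := SMap {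
  smap_fun :> V -> W;
  smap_simplex : forall s, simplices K s -> simplices L (smap_fun @` s)
}.

Lemma smap_comp_simplex (V W Z : Type) (K : scomplex V) (L : scomplex W)
    (M : scomplex Z) (g : smap L M) (f : smap K L) (s : set V) :
  simplices K s -> simplices M ((g \o f) @` s).
Proof. by move=> Ks; rewrite -image_comp; do 2 apply: smap_simplex. Qed.

Definition smap_comp (V W Z : Type) (K : scomplex V) (L : scomplex W)
    (M : scomplex Z) (g : smap L M) (f : smap K L) : smap K M :=
  SMap (smap_comp_simplex g f).

(* A point of the geometric realization is a family of barycentric coordinates
   whose support is a simplex; since simplices are finite, the sum below has
   finite support. [{classic V}] is [V] with a choice structure, which the sum
   over a set of indices requires. *)
Record realization (F : realType) (V : Type) (K : scomplex V) := Realization {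
  bary :> V -> F;
  bary_ge0 : forall v, 0 <= bary v;
  bary_support : simplices K [set v | bary v != 0];
  bary_sum : \sum_(v \in [set: {classic V}]) bary v = 1
}.

HB.instance Definition _ (F : realType) (V : Type) (K : scomplex V) :=
  gen_eqMixin (realization F K).
HB.instance Definition _ (F : realType) (V : Type) (K : scomplex V) :=
  gen_choiceMixin (realization F K).

Section coherent_topology.
Variables (F : realType) (V : Type) (K : scomplex V).

Definition closed_simplex (s : set V) : set (realization F K) :=
  [set a | [set v | a v != 0] `<=` s].

(* Each closed simplex carries its Euclidean topology, that is, the one induced
   by the product topology on [V -> F] (only the finitely many coordinates in
   [s] matter); a set is open in the realization when its trace on every closed
   simplex is open there. *)
Definition coherent_open (U : set (realization F K)) : Prop :=
  forall s, simplices K s -> exists2 W : set {ptws V -> F}, open W &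
    closed_simplex s `&` U =
    closed_simplex s `&` [set a | W (bary a)].

Lemma coherent_openT : coherent_open setT.
Proof. by move=> s _; exists setT => //; exact: openT. Qed.

Lemma coherent_openI : setI_closed coherent_open.
Proof.
move=> A B oA oB s Ks.
have [W oW eW] := oA s Ks; have [Z oZ eZ] := oB s Ks.
exists (W `&` Z); first exact: openI.
by rewrite -[closed_simplex s in LHS]setIid setIACA eW eZ setIACA setIid.
Qed.

Lemma coherent_open_bigU (I : Type) (f : I -> set (realization F K)) :
  (forall i, coherent_open (f i)) -> coherent_open (\bigcup_i f i).
Proof.
move=> of_ s Ks.
have /choice[W WP] : forall i, exists W : set {ptws V -> F}, open W /\
    closed_simplex s `&` f i = closed_simplex s `&` [set a | W (bary a)].
  by move=> i; have [W oW eW] := of_ i s Ks; exists W.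
exists (\bigcup_i W i); first by apply: bigcup_open => i _; case: (WP i).
apply/seteqP; split=> a [sa] [i _ ia]; split=> //; exists i => //.
- have [_ e] := WP i.
  by have [] : (closed_simplex s `&` [set a | W i (bary a)]) a by rewrite -e.
- have [_ e] := WP i.
  by have [] : (closed_simplex s `&` f i) a by rewrite e.
Qed.

HB.instance Definition _ := isOpenTopological.Build (realization F K)
  coherent_openT coherent_openI coherent_open_bigU.

End coherent_topology.

Section realization_map.
Variables (F : realType) (V W : Type) (K : scomplex V) (L : scomplex W).
Variable f : smap K L.

Definition push_bary (a : realization F K) (w : W) : F :=
  \sum_(v \in [set v : {classic V} | f v = w]) a v.

Lemma push_bary_ge0 a w : 0 <= push_bary a w.
Proof. by apply: fsumr_ge0 => v _; exact: bary_ge0. Qed.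

Lemma finite_bary_support (a : realization F K) :
  finite_set [set v : {classic V} | a v != 0].
Proof. exact: simplex_finite (bary_support a). Qed.

Lemma push_baryE a w :
  push_bary a w =
  \sum_(v \in [set v : {classic V} | a v != 0])
    (if (f v : {classic W}) == w then a v else 0).
Proof.
rewrite /push_bary fsbig_mkcond [RHS]fsbig_mkcond; apply: eq_fsbigr => v _.
rewrite /patch; have [av0|av0] := eqVneq (a v) 0.
  by rewrite av0 !if_same.
rewrite [v \in [set v | a v != 0]](_ : _ = true); last exact: mem_set.
by congr (if _ then _ else _); apply/idP/eqP => [/set_mem|fvw]//; exact: mem_set.
Qed.

Lemma push_bary_supportE a :
  [set w | push_bary a w != 0] = f @` [set v | a v != 0].
Proof.
apply/seteqP; split=> w /=.
- apply: contra_neqP => nw; apply: fsbig1 => v /= fvw.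
  by apply/eqP; apply: contrapT => /negP av0; apply: nw; exists v.
- case=> v av0 fvw; rewrite push_baryE; apply/eqP.
  move=> /(pfsumr_eq0 (finite_bary_support a)) H.
  have := H _ v av0; rewrite fvw eqxx => av0'.
  by move/eqP: av0; apply; apply: av0' => u _; case: ifP => // _; exact: bary_ge0.
Qed.

Lemma push_bary_support a : simplices L [set w | push_bary a w != 0].
Proof.
by rewrite push_bary_supportE; apply: smap_simplex; exact: bary_support.
Qed.

Lemma push_bary_sum a : \sum_(w \in [set: {classic W}]) push_bary a w = 1.
Proof.
pose S : set {classic V} := [set v | a v != 0].
have finS : finite_set S := finite_bary_support a.
have finT : finite_set ((f : {classic V} -> {classic W}) @` S).
  exact: finite_image.
rewrite -(bary_sum a) [RHS](_ : _ = \sum_(v \in S) a v); last first.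
  rewrite fsbig_supp; apply: eq_fsbigl.
  by apply/seteqP; split=> v /=; [case=> _ /eqP|move=> /eqP].
rewrite [LHS](_ : _ =
    \sum_(w \in (f : {classic V} -> {classic W}) @` S) push_bary a w); last first.
  apply/esym/fsbig_widen => // w [_ nw] /=; apply: contrapT => /eqP pw.
  by apply: nw; have := push_bary_supportE a; move/seteqP => [+ _]; apply.
under eq_fsbigr do rewrite push_baryE.
rewrite exchange_fsbig//; apply: eq_fsbigr => v /set_mem Sv.
rewrite (fsbigD1 (f v : {classic W}))//=; last by exists v.
rewrite eqxx fsbig1 ?addr0// => w /= [_ /eqP]; rewrite eq_sym.
by move=> /negPf ->.
Qed.

Definition realization_map (a : realization F K) : realization F L :=
  Realization (push_bary_ge0 a) (push_bary_support a) (push_bary_sum a).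

End realization_map.
Arguments realization_map F {V W K L} f a.

(* Only the restriction of [H] to [T * [0, 1]] matters. *)
Definition homotopic (F : realType) (T U : topologicalType) (f g : T -> U) :=
  exists H : T * F -> U,
    [/\ {within [set: T] `*` `[0, 1], continuous H},
        forall x, H (x, 0) = f x & forall x, H (x, 1) = g x].

Definition homotopy_equivalence (F : realType) (T U : topologicalType)
    (f : T -> U) :=
  continuous f /\
  exists g : U -> T,
    [/\ continuous g, homotopic F (g \o f) id & homotopic F (f \o g) id].

(* A relation (R, X, Y) is a set [R : set (X * Y)], X and Y being types. *)
Record rel_morphism (X0 Y0 X1 Y1 : Type) (R0 : set (X0 * Y0))
    (R1 : set (X1 * Y1)) := RelMorphism {
  mor1 : X0 -> X1;
  mor2 : Y0 -> Y1;
  morP : forall x y, R0 (x, y) -> R1 (mor1 x, mor2 y)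
}.
Arguments morP {X0 Y0 X1 Y1 R0 R1} r x y _.

Definition transpose (X Y : Type) (R : set (X * Y)) : set (Y * X) :=
  [set yx | R (yx.2, yx.1)].

Definition transpose_morphism (X0 Y0 X1 Y1 : Type) (R0 : set (X0 * Y0))
    (R1 : set (X1 * Y1)) (f : rel_morphism R0 R1) :
    rel_morphism (transpose R0) (transpose R1) :=
  @RelMorphism _ _ _ _ (transpose R0) (transpose R1) (mor2 f) (mor1 f)
    (fun y x => morP f x y).

Section dowker.
Variables (X Y : Type) (R : set (X * Y)).

Definition dowker_simplices : set (set X) :=
  [set s | [/\ finite_set s, s !=set0 & exists y, s `*` [set y] `<=` R]].

Lemma dowker_finite s : dowker_simplices s -> finite_set s.
Proof. by case. Qed.

Lemma dowker_neq0 s : dowker_simplices s -> s !=set0.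
Proof. by case. Qed.

Lemma dowker_sub s t : dowker_simplices s -> t !=set0 -> t `<=` s ->
  dowker_simplices t.
Proof.
move=> [fs _ [y sy]] t0 ts; split=> //; first exact: sub_finite_set fs.
by exists y => -[x z] [/= /ts sx zy]; apply: sy.
Qed.

Definition dowker : scomplex X := SComplex dowker_finite dowker_neq0 dowker_sub.

End dowker.

(* [R] is coerced to the type of its elements, the vertices of E(R). *)
Section rectangle.
Variables (X Y : Type) (R : set (X * Y)).

Definition rel_fst (r : R) : X := (val r).1.
Definition rel_snd (r : R) : Y := (val r).2.

Definition rectangle_simplices : set (set R) :=
  [set t | [/\ finite_set t, t !=set0 &
               (rel_fst @` t) `*` (rel_snd @` t) `<=` R]].

Lemma rectangle_finite s : rectangle_simplices s -> finite_set s.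
Proof. by case. Qed.

Lemma rectangle_neq0 s : rectangle_simplices s -> s !=set0.
Proof. by case. Qed.

Lemma rectangle_sub s t : rectangle_simplices s -> t !=set0 -> t `<=` s ->
  rectangle_simplices t.
Proof.
move=> [fs _ sR] t0 ts; split=> //; first exact: sub_finite_set fs.
apply: subset_trans sR => -[x y] [/= [r tr rx] [q tq qy]].
by split=> /=; [exists r => //; exact: ts|exists q => //; exact: ts].
Qed.

Definition rectangle : scomplex R :=
  SComplex rectangle_finite rectangle_neq0 rectangle_sub.

Lemma rel_fst_simplex t :
  simplices rectangle t -> simplices (dowker R) (rel_fst @` t).
Proof.
move=> [ft [r tr] tR]; split; first exact: finite_image.
  by exists (rel_fst r), r.
exists (rel_snd r) => -[x y] [/= tx ->]; apply: tR; split=> //=.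
by exists r.
Qed.

Lemma rel_snd_simplex t :
  simplices rectangle t -> simplices (dowker (transpose R)) (rel_snd @` t).
Proof.
move=> [ft [r tr] tR]; split; first exact: finite_image.
  by exists (rel_snd r), r.
exists (rel_fst r) => -[y x] [/= ty ->]; apply: tR; split=> //=.
by exists r.
Qed.

Definition rect_proj : smap rectangle (dowker R) := SMap rel_fst_simplex.

Definition rect_proj_hat : smap rectangle (dowker (transpose R)) :=
  SMap rel_snd_simplex.

End rectangle.

Section induced_maps.
Variables (X0 Y0 X1 Y1 : Type) (R0 : set (X0 * Y0)) (R1 : set (X1 * Y1)).
Variable f : rel_morphism R0 R1.

Lemma mor1_simplex s :
  simplices (dowker R0) s -> simplices (dowker R1) (mor1 f @` s).
Proof.
move=> [fs [x sx] [y sy]]; split; first exact: finite_image.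
  by exists (mor1 f x), x.
exists (mor2 f y) => -[_ _] [/= [u su <-] ->]; apply: morP.
exact: (sy (u, y)).
Qed.

Definition dowker_map : smap (dowker R0) (dowker R1) := SMap mor1_simplex.

Lemma rectangle_vertex_subproof (r : R0) :
  (mor1 f (rel_fst r), mor2 f (rel_snd r)) \in R1.
Proof.
by apply/mem_set/(morP f); case: r => -[x y] h; exact: (set_mem h).
Qed.

Definition rectangle_vertex (r : R0) : R1 :=
  exist (fun p => p \in R1) (mor1 f (rel_fst r), mor2 f (rel_snd r))
    (rectangle_vertex_subproof r).

Lemma rectangle_vertex_simplex t :
  simplices (rectangle R0) t -> simplices (rectangle R1) (rectangle_vertex @` t).
Proof.
move=> [ft [r tr] tR]; split; first exact: finite_image.
  by exists (rectangle_vertex r), r.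
move=> [_ _] [/= [_ [p tp <-] <-] [_ [q tq <-] <-]].
by apply: morP; apply: (tR (_, _)); split=> /=; [exists p|exists q].
Qed.

Definition rectangle_map : smap (rectangle R0) (rectangle R1) :=
  SMap rectangle_vertex_simplex.

End induced_maps.

(* Main.v *)
Require Import Defs.
From mathcomp Require Import all_boot all_order all_algebra.
From mathcomp Require Import all_classical all_reals all_analysis.
From mathcomp Require Import finmap lra.

(* Let [p : E(R) -> D(R)] be the projection. For a point [a] of |D(R)| put
   level(a) = (1/2) sum_x a(x)^2, which is positive and smaller than max a.
   Choosing for each simplex s of D(R) some y(s) with s x {y(s)} contained in R,
   a homotopy inverse of |p| is
     g(a)(x, y) = high_a(x) * sum_{s : y(s) = y} weight_a(s)   (normalized),
   where high_a(x) = max(0, a(x) - level(a)), and where weight_a(s) vanishes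
   unless s lies in the support of a and contains {x | a(x) > level(a)}: the
   support of g(a) is then a rectangle.
   The segment from |p|(g(a)) to a stays in the simplex supp(a). From g(|p|(e))
   to e one goes along two segments, through the point
     h(e)(x, y) = high_{|p|(e)}(x) * (Y-marginal of e)(y)   (normalized):
   supp(h(e)) and supp(e) lie in the rectangle spanned by supp(e), while
   supp(h(e)) and supp(g(|p|(e))) share their X-side {x | |p|(e)(x) > level},
   all of whose points are related to every y occurring in either.
   For the continuity of homotopies, the product of |K| with a compact interval
   has the coherent topology, by the tube lemma.
   The argument only uses that a vertex of E(R) is determined by its two
   projections, so it applies to both of them. *)

Set Implicit Arguments.
Unset Strict Implicit.
Unset Printing Implicit Defensive.

Import Order.TTheory GRing.Theory Num.Theory.
Import numFieldNormedType.Exports.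

Local Open Scope classical_set_scope.
Local Open Scope ring_scope.

(** * Pointwise convergence and finite power sets *)

Lemma ptws_eval_continuous (F : topologicalType) (V : Type) (v : V) :
  continuous (fun w : {ptws V -> F} => w v).
Proof. exact: (@proj_continuous {classic V} (fun=> F) v). Qed.

Lemma ptws_cvg (F : topologicalType) (V T : Type) (G : set_system T)
    (f : T -> V -> F) (l : V -> F) : Filter G ->
  (forall v, f x v @[x --> G] --> l v) ->
  (f x : {ptws V -> F}) @[x --> G] --> (l : {ptws V -> F}).
Proof.
move=> FG fl; apply/cvg_sup => v A [B] [[W] oW <-] Wl WA.
apply: (filterS WA); apply: (fl v W).
exact: open_nbhs_nbhs.
Qed.

Lemma finite_powerset (T : Type) (S : set T) :
  finite_set S -> finite_set [set t | t `<=` S].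
Proof.
move=> finS.
pose fS : {fset {classic T}} := fset_set (S : set {classic T}).
pose im := (fun A : {fset {classic T}} => [set x : T | (x : {classic T}) \in A])
  @` [set` fpowerset fS].
have finim : finite_set im by apply: finite_image; exact: finite_fset.
apply: sub_finite_set finim.
move=> t tS; have fint : finite_set t by exact: sub_finite_set finS.
exists (fset_set (t : set {classic T})).
  rewrite /= fpowersetE; apply/fsubsetP => x; rewrite !in_fset_set//.
  by move/set_mem/tS => ?; exact: mem_set.
by apply/seteqP; split=> x /=; rewrite in_fset_set//; [move/set_mem|move/mem_set].
Qed.

(** * The coherent topology through neighbourhoods within closed simplices *)

Section trace_filter.
Variables (F : realType) (V : Type) (K : scomplex V).
Implicit Types (s : set V) (a : realization F K) (A : set (realization F K)).

(* The neighbourhoods of [a] within the closed simplex [s]. *)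
Definition trace_nbhs s a : set_system (realization F K) :=
  [set A | nbhs (bary a : {ptws V -> F})
     [set w | forall b, closed_simplex s b -> bary b = w -> A b]].

Global Instance trace_nbhs_filter s a : Filter (trace_nbhs s a).
Proof.
split.
- exact: (@filterE _ _ (nbhs_filter (bary a : {ptws V -> F}))).
- move=> A B nA nB.
  apply: (@filterS2 _ _ (nbhs_filter (bary a : {ptws V -> F})) _ _ _ _ nA nB).
  move=> w wA wB b sb bw.
  by split; [exact: wA|exact: wB].
- move=> A B AB nA.
  apply: (@filterS _ _ (nbhs_filter (bary a : {ptws V -> F})) _ _ _ nA).
  by move=> w wA b sb bw; exact/AB/wA.
Qed.

Lemma trace_nbhs_closed_simplex s a : trace_nbhs s a (closed_simplex s).
Proof. by apply: (@filterE _ _ (nbhs_filter (bary a : {ptws V -> F}))) => w b. Qed.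

Lemma trace_nbhs_singleton s a A :
  closed_simplex s a -> trace_nbhs s a A -> A a.
Proof.
move=> sa nA.
by apply: (@nbhs_singleton _ (bary a : {ptws V -> F}) _ nA).
Qed.

Lemma trace_nbhs_nbhs s a A : simplices K s -> closed_simplex s a ->
  nbhs a A -> trace_nbhs s a A.
Proof.
move=> Ks sa; rewrite nbhsE => -[B [oB Ba] BA].
have [W oW eW] := oB s Ks.
have [_ Wa] : (closed_simplex s `&` [set a | W (bary a)]) a by rewrite -eW.
have := open_nbhs_nbhs (conj oW Wa).
apply: (@filterS _ _ (nbhs_filter (bary a : {ptws V -> F}))).
move=> w Ww b sb bw; apply: BA.
by have [] : (closed_simplex s `&` B) b by rewrite eW /= bw.
Qed.

Lemma open_trace_nbhs A :
  (forall s a, simplices K s -> closed_simplex s a -> A a ->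
     trace_nbhs s a A) -> open A.
Proof.
move=> trA; suff : coherent_open A by [].
(* Functions that are not the coordinates of a point of the closed simplex lie in [W] vacuously;
   they disappear on intersecting with [closed_simplex s]. *)
move=> s Ks; pose W : set {ptws V -> F} :=
  [set w | forall b, closed_simplex s b -> bary b = w -> A b].
exists W^°; first exact: open_interior.
apply/seteqP; split=> a [sa] => [Aa|/interior_subset Wa].
  by split=> //; exact: trA.
by split=> //; exact: Wa.
Qed.

Lemma bary_cvg s a v : b v @[b --> trace_nbhs s a] --> a v.
Proof.
move=> A /(@ptws_eval_continuous F V v (bary a)) nA.
apply: (@filterS _ _ (nbhs_filter (bary a : {ptws V -> F})) _ _ _ nA).
by move=> w /= Aw b sb bw; rewrite bw.
Qed.

Lemma continuous_trace (U : topologicalType) (f : realization F K -> U) :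
  (forall s a, simplices K s -> closed_simplex s a ->
     f b @[b --> trace_nbhs s a] --> f a) -> continuous f.
Proof.
move=> fc; apply/continuousP => O oO; apply: open_trace_nbhs => s a Ks sa Oa.
by apply: (fc s a Ks sa O); exact: open_nbhs_nbhs.
Qed.

Lemma cvg_trace (U : topologicalType) (f : realization F K -> U) s a :
  simplices K s -> closed_simplex s a -> continuous f ->
  f b @[b --> trace_nbhs s a] --> f a.
Proof. by move=> Ks sa fc A /fc; exact: trace_nbhs_nbhs. Qed.

Lemma closed_simplex_support a : closed_simplex [set v | a v != 0] a.
Proof. by []. Qed.

(** Tube lemma: if [H] sends [{a} * J] into the open set [B], with [J] a compact interval around
    [t], then the set [Q] of all [b] with the same property is open, and [Q * J] is the required
    neighbourhood of [(a, t)]. *)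
Lemma homotopy_trace (U : topologicalType) (H : realization F K * F -> U) :
  (forall s a t, simplices K s -> closed_simplex s a ->
     H x @[x --> filter_prod (trace_nbhs s a) (nbhs t)] --> H (a, t)) ->
  continuous H.
Proof.
move=> Hc [a t] C /=; rewrite nbhsE => -[B [oB Bat] BC].
have nO s b u : simplices K s -> closed_simplex s b -> B (H (b, u)) ->
    filter_prod (trace_nbhs s b) (nbhs u) [set x | B (H x)].
  move=> Ks sb Bbu; apply: (Hc s b u Ks sb B).
  by apply: open_nbhs_nbhs.
have [e e0 He] : exists2 e : F, 0 < e &
    forall u, t - e <= u <= t + e -> B (H (a, u)).
  have [[A D] /= [nA nD] AD] := nO _ a t (bary_support a)
    (@closed_simplex_support a) Bat.
  have /nbhs_ballP[e /= e0 eD] := nD; exists (e / 2); first by rewrite divr_gt0.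
  move=> u /= ute; apply: (AD (a, u)); split => /=.
    exact: (trace_nbhs_singleton (@closed_simplex_support a) nA).
  apply: eD; rewrite /ball /=; case/andP: ute => h1 h2.
  have e20 : 0 < e / 2 by rewrite divr_gt0.
  rewrite ltr_norml; apply/andP; split; lra.
pose J : set F := [set` `[t - e, t + e]].
have cJ : compact J by exact: segment_compact.
pose Q : set (realization F K) := [set b | forall u, J u -> B (H (b, u))].
have oQ : open Q.
  apply: open_trace_nbhs => s b Ks sb Qb.
  have /compact_near_coveringP cov := cJ.
  have FT := trace_nbhs_filter s b.
  (* Compactness of [J] turns neighbourhoods of [b] that depend on [u] into a single one, inside the
     closed simplex [s]. *)
  apply: (cov _ (trace_nbhs s b) (fun b u => B (H (b, u))) FT) => u Ju.
  have [[A D] /= [nA nD] AD] := nO s b u Ks sb (Qb u Ju).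
  by exists (D, A) => // -[u' b'] /= [Du Ab]; exact: (AD (b', u')).
exists (Q, J) => /=.
  split.
    by apply: open_nbhs_nbhs; split=> // u; rewrite /J /= in_itv; exact: He.
  apply/nbhs_ballP; exists e => //= u; rewrite /ball /= ltr_norml => /andP[h1 h2].
  by rewrite /J /= in_itv /=; apply/andP; split; lra.
by move=> [b u] /= [Qb Ju]; apply: BC; exact: Qb.
Qed.

End trace_filter.

(** * Coordinatewise convergence in a realization *)

Lemma filter_forall_finite (I T : Type) (G : set_system T) (S : set I)
    (P : I -> set T) : Filter G -> finite_set S ->
  (forall i, S i -> G (P i)) -> G [set x | forall i, S i -> P i x].
Proof.
move=> FG finS GP.
have := @filter_bigI T {classic I} (fset_set (S : set {classic I})) P G FG.
move=> /(_ _)/[!fset_setK]// H; apply: filterS (H _) => [x Px i Si|i].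
  exact: Px.
by rewrite in_fset_set// => /set_mem; exact: GP.
Qed.

(** A finite [S] has finitely many faces, so one member of [G] serves all the closed faces
    containing [b]; on each of them the topology is the pointwise one. *)
Lemma cvg_realization (F : realType) (V T : Type) (K : scomplex V)
    (G : set_system T) (f : T -> realization F K) (b : realization F K)
    (S : set V) : Filter G -> finite_set S ->
  G [set x | closed_simplex S (f x)] ->
  (forall v, f x v @[x --> G] --> b v) -> f x @[x --> G] --> b.
Proof.
move=> FG finS GS fb B nB.
have fb_ptws := ptws_cvg FG fb.
have Gface : G [set x | forall t, t `<=` S -> simplices K t ->
    closed_simplex t b -> closed_simplex t (f x) -> B (f x)].
  apply: (filter_forall_finite FG (finite_powerset finS)) => t tS.
  have [[Kt tb]|nt] := pselect (simplices K t /\ closed_simplex t b); last first.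
    by apply: (@filterE _ G FG) => x Kt tb; case: nt.
  have Gt : G [set x | forall c, closed_simplex t c -> bary c = bary (f x) ->
    B c] := fb_ptws _ (trace_nbhs_nbhs Kt tb nB).
  by apply: (filterS _ Gt) => x fx _ _ tfx; exact: fx.
(* This puts [b] in the closed face spanned by the support of [f x], the face to which [Gface] is
   applied. *)
have Gsupp : G [set x | forall v, b v != 0 -> f x v != 0].
  apply: (filter_forall_finite FG (finite_bary_support b)) => v bv.
  exact: (@cvgr_neq0 F F T G FG _ _ (fb v) bv).
suff : G [set x | B (f x)] by [].
apply: filterS3 Gface GS Gsupp => x /= face Sx suppx.
by apply: (face [set v | f x v != 0]) => //; exact: bary_support.
Qed.

(** * Finitely supported sums over an arbitrary index type *)

Section mass.
Variables (F : realType) (I : Type).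
Implicit Types phi : I -> F.

(* The value is 0 when [phi] has infinite support. *)
Definition mass phi : F := \sum_(i \in [set: {classic I}]) phi i.

Lemma mass_finite (S : set {classic I}) phi : finite_set S ->
  (forall i, phi i != 0 -> S i) ->
  mass phi = \sum_(i <- fset_set S) phi i.
Proof.
move=> finS phiS; rewrite -(fsbig_finite _ _ finS); apply/esym/fsbig_widen => //.
by move=> i [_ nSi] /=; apply/eqP; apply: contra_notT nSi => /phiS.
Qed.

Lemma mass_ge0 phi : (forall i, 0 <= phi i) -> 0 <= mass phi.
Proof. by move=> phi0; exact: fsumr_ge0. Qed.

Lemma le_mass phi i : finite_set [set i | phi i != 0] ->
  (forall i, 0 <= phi i) -> phi i <= mass phi.
Proof.
move=> fin phi0; have [->|ni] := eqVneq (phi i) 0; first exact: mass_ge0.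
rewrite (@mass_finite [set i | phi i != 0])// -fsbig_finite//.
rewrite (fsbigD1 (i : {classic I}))//= lerDl.
by apply: fsumr_ge0 => j _; exact: phi0.
Qed.

Lemma mass_gt0 phi i : finite_set [set i | phi i != 0] ->
  (forall i, 0 <= phi i) -> phi i != 0 -> 0 < mass phi.
Proof.
move=> fin phi0 ni; apply: lt_le_trans (le_mass i fin phi0).
by rewrite lt0r ni phi0.
Qed.

End mass.

(** * Locally finite families of continuous functions *)

Section continuous_family.
Variables (F : realType) (V : Type) (K : scomplex V).

(* On each finite subcomplex only finitely many members of the family are not
   identically zero, so that sums of members are continuous. *)
Definition continuous_family (I : Type) (phi : realization F K -> I -> F) :=
  (forall i, continuous (phi ^~ i)) /\
  forall S, finite_set S -> exists2 S', finite_set S' &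
    forall a, closed_simplex S a -> [set i | phi a i != 0] `<=` S'.

Lemma continuous_family_finite (I : Type) (phi : realization F K -> I -> F) a :
  continuous_family phi -> finite_set [set i | phi a i != 0].
Proof.
move=> [_ /(_ _ (simplex_finite (bary_support a)))[S finS aS]].
by apply: sub_finite_set finS; exact: aS.
Qed.

Lemma continuous_mass (I : Type) (phi : realization F K -> I -> F) :
  continuous_family phi -> continuous (fun a => mass (phi a)).
Proof.
move=> [phic phiS]; apply: continuous_trace => s a Ks sa.
have [S finS sS] := phiS s (simplex_finite Ks).
have E b : closed_simplex s b -> \sum_(i <- fset_set (S : set {classic I})) phi b i
    = mass (phi b) by move=> /sS bS; rewrite (mass_finite finS).
rewrite -(E a sa).
apply: cvg_trans (_ : (fun b => \sum_(i <- fset_set (S : set {classic I})) phi b i)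
    @ trace_nbhs s a --> _).
  apply: near_eq_cvg; apply: filterS (@trace_nbhs_closed_simplex _ _ _ s a).
  by move=> b /E.
apply: cvg_big => [|i _]; first exact: add_continuous.
exact: cvg_trace.
Qed.

Lemma continuous_family_bary : continuous_family (fun a : realization F K => a).
Proof.
split=> [v|S finS]; last by exists S.
by apply: continuous_trace => s a Ks sa; exact: bary_cvg.
Qed.

(** Counterpart of [push_bary] for functions that need not be barycentric coordinates, such as the
    weights of simplices. *)
Definition push (I J : Type) (f : I -> J) (phi : I -> F) (j : J) : F :=
  mass (fun i => if (f i : {classic J}) == j then phi i else 0).

Lemma push_neq0 (I J : Type) (f : I -> J) (phi : I -> F) j :
  push f phi j != 0 -> exists2 i, f i = j & phi i != 0.
Proof.
apply: contraNP => nex; apply/eqP/fsbig1 => i _; case: eqP => // fij.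
by apply/eqP; apply: contra_notT nex => ?; exists i.
Qed.

Lemma push_ge0 (I J : Type) (f : I -> J) (phi : I -> F) j :
  (forall i, 0 <= phi i) -> 0 <= push f phi j.
Proof. by move=> phi0; apply: mass_ge0 => i; case: ifP. Qed.

Lemma push_image_neq0 (I J : Type) (f : I -> J) (phi : I -> F) i :
  finite_set [set i | phi i != 0] -> (forall i, 0 <= phi i) ->
  phi i != 0 -> push f phi (f i) != 0.
Proof.
move=> fin phi0 ni; apply: lt0r_neq0; apply: (@mass_gt0 _ _ _ i).
- apply: sub_finite_set fin => k /=.
  by case: ifP => //; rewrite eqxx.
- by move=> k; case: ifP.
- by rewrite eqxx.
Qed.

Lemma continuous_family_push (I J : Type) (f : I -> J) phi :
  continuous_family phi -> continuous_family (fun a => push f (phi a)).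
Proof.
move=> phif; have [phic phiS] := phif; split=> [j|S finS].
  apply: continuous_mass; split=> [i|S finS].
    rewrite /=; case: (f i =P j :> {classic J}) => _ a; first exact: phic.
    exact: cst_continuous.
  have [S' finS' aS'] := phiS S finS; exists S' => // a Sa i /= n0.
  by apply: (aS' a Sa) => /=; move: n0; case: ifP => //; rewrite eqxx.
have [S' finS' aS'] := phiS S finS; exists (f @` S').
  exact: finite_image.
move=> a Sa j /= pj; have [i <- n0] := push_neq0 pj.
by exists i => //; exact: (aS' a).
Qed.

(** Since an index [n] is determined by the pair [(i n, j n)], a finite product of index sets has a
    finite preimage in [N]. *)
Lemma continuous_family_prod (I J N : Type) (i : N -> I) (j : N -> J) phi psi :
  (forall m n, i m = i n -> j m = j n -> m = n) ->
  continuous_family phi -> continuous_family psi ->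
  continuous_family (fun a n => phi a (i n) * psi a (j n)).
Proof.
move=> ij [phic phiS] [psic psiS]; split=> [n a|S finS].
  by apply: continuousM; [exact: phic|exact: psic].
have [S1 fin1 aS1] := phiS S finS; have [S2 fin2 aS2] := psiS S finS.
exists ((fun n => (i n, j n)) @^-1` (S1 `*` S2)).
  apply: finite_preimage; last exact: finite_setX.
  by move=> m n _ _ [/ij]; exact.
move=> a Sa n /=; rewrite mulf_eq0 negb_or => /andP[n1 n2].
by split; [exact: (aS1 a)|exact: (aS2 a)].
Qed.

End continuous_family.

(** * Maps between realizations given by continuous families *)

Lemma realization_mapE (F : realType) (V W : Type) (K : scomplex V)
    (L : scomplex W) (f : smap K L) (a : realization F K) (w : W) :
  realization_map F f a w = push f a w.
Proof.
rewrite /= /push_bary fsbig_mkcond; apply: eq_fsbigr => v _; rewrite /patch.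
by congr (if _ then _ else _); apply/idP/eqP => [/set_mem|fvw]//; exact: mem_set.
Qed.

Section continuous_family_maps.
Variables (F : realType) (V W : Type) (K : scomplex V) (L : scomplex W).

(** Local finiteness supplies the finite vertex set that [cvg_realization] requires on each closed
    simplex. *)
Lemma continuous_family_continuous (f : realization F K -> realization F L) :
  continuous_family (fun a => bary (f a)) -> continuous f.
Proof.
move=> [fc fS]; apply: continuous_trace => s a Ks sa.
have [S finS sS] := fS s (simplex_finite Ks).
apply: (cvg_realization _ finS) => [|v].
  by apply: filterS (@trace_nbhs_closed_simplex _ _ _ s a); exact: sS.
exact: (cvg_trace Ks sa (fc v)).
Qed.

Lemma continuous_family_comp (I : Type) (phi : realization F L -> I -> F)
    (f : realization F K -> realization F L) :
  continuous_family (fun a => bary (f a)) -> continuous_family phi ->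
  continuous_family (fun a => phi (f a)).
Proof.
move=> ff [phic phiS]; split=> [i a|S finS].
  apply: (@continuous_comp _ _ _ f (phi ^~ i)); last exact: phic.
  exact: continuous_family_continuous.
have [S' finS' fS'] := ff.2 S finS; have [S'' finS'' phiS''] := phiS S' finS'.
by exists S'' => // a Sa; apply: phiS''; exact: fS'.
Qed.

Lemma continuous_family_realization_map (f : smap K L) :
  continuous_family (fun a => bary (realization_map F f a)).
Proof.
have -> : (fun a => bary (realization_map F f a)) = fun a => push f (bary a).
  by apply/funext => a; apply/funext => w; exact: realization_mapE.
exact/continuous_family_push/continuous_family_bary.
Qed.

(** Division by the total mass, which is positive because a simplex is non-empty. Only the support
    of the result is recorded: contiguity arguments need nothing else. *)
Lemma normalize (phi : realization F K -> W -> F) :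
  continuous_family phi -> (forall a w, 0 <= phi a w) ->
  (forall a, simplices L [set w | phi a w != 0]) ->
  exists2 f : realization F K -> realization F L,
    continuous_family (fun a => bary (f a)) &
    forall a, [set w | f a w != 0] = [set w | phi a w != 0].
Proof.
move=> phif phi0 phiL.
have t0 a : 0 < mass (phi a).
  have [w aw] := simplex_neq0 (phiL a).
  exact: (mass_gt0 (continuous_family_finite a phif) (phi0 a) aw).
have psupp a : [set w | phi a w / mass (phi a) != 0] = [set w | phi a w != 0].
  apply/funext => w /=; rewrite mulf_eq0 invr_eq0 negb_or (gt_eqF (t0 a)).
  by rewrite andbT.
have /choice[f fE] : forall a, exists b : realization F L,
    forall w, b w = phi a w / mass (phi a).
  move=> a.
  have p0 w : 0 <= phi a w / mass (phi a) by rewrite divr_ge0// ltW.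
  have pL : simplices L [set w | phi a w / mass (phi a) != 0].
    by rewrite psupp.
  have p1 : \sum_(w \in [set: {classic W}]) (phi a w / mass (phi a)) = 1.
    by rewrite -mulr_fsuml; exact: (divff (lt0r_neq0 (t0 a))).
  by exists (Realization p0 pL p1).
have fEE : (fun a => bary (f a)) = fun a w => phi a w / mass (phi a).
  by apply/funext => a; apply/funext => w.
exists f; last by move=> a; rewrite -psupp; apply/funext => w /=; rewrite fE.
rewrite fEE; split=> [w a|S finS].
  apply: (@continuousM F _ (phi ^~ w) (fun a => (mass (phi a))^-1) a).
    exact: phif.1.
  by apply: continuousV; [rewrite gt_eqF|exact: continuous_mass].
have [S' finS' aS'] := phif.2 S finS; exists S' => // a Sa.
by rewrite psupp; exact: aS'.
Qed.

End continuous_family_maps.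

(** * Homotopies along segments inside simplices *)

Section homotopy.
Variable F : realType.

(** Retraction of the line onto the unit interval, which makes the homotopy below continuous for
    every time in [F]. *)
Definition clamp (t : F) : F := Num.max 0 (Num.min 1 t).

Lemma continuous_clamp : continuous clamp.
Proof.
move=> t; apply: (@continuous_max F F (cst 0) (fun t => Num.min 1 t)).
  exact: cst_continuous.
by apply: (@continuous_min F F (cst 1) id); [exact: cst_continuous|exact: cvg_id].
Qed.

Lemma clamp_itv t : 0 <= clamp t <= 1.
Proof. by rewrite /clamp le_max lexx ge_max ler01 ge_min lexx. Qed.

Lemma clamp_le0 t : t <= 0 -> clamp t = 0.
Proof.
by move=> t0; rewrite /clamp max_l// ge_min t0 orbT.
Qed.

Lemma clamp_ge1 t : 1 <= t -> clamp t = 1.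
Proof. by move=> t1; rewrite /clamp min_l// max_r. Qed.

Variables (V W : Type) (K : scomplex V) (L : scomplex W).

(* The homotopy follows the segment from [f a] to [g a], then the one from [g a]
   to [h a], as a single convex combination, which avoids pasting. *)
Lemma homotopic_contiguous (f g h : realization F K -> realization F L) :
  continuous_family (fun a => bary (f a)) ->
  continuous_family (fun a => bary (g a)) ->
  continuous_family (fun a => bary (h a)) ->
  (forall a, simplices L ([set w | f a w != 0] `|` [set w | g a w != 0])) ->
  (forall a, simplices L ([set w | g a w != 0] `|` [set w | h a w != 0])) ->
  homotopic F f h.
Proof.
move=> fF gF hF fgL ghL.
(* [al] rises from 0 to 1 on the first half of the interval and [be] on the second. As [be t = 0] or
   [al t = 1], either [h] or [f] has coefficient 0 in [c], so the support lies in one of the two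
   given unions. *)
pose al (t : F) := clamp (2 * t); pose be (t : F) := clamp (2 * t - 1).
have al01 t : 0 <= al t <= 1 := clamp_itv _.
have be01 t : 0 <= be t <= 1 := clamp_itv _.
have be0_al1 t : be t = 0 \/ al t = 1.
  by have [t0|t0] := leP (2 * t - 1) 0; [left; exact: clamp_le0|
     right; apply: clamp_ge1; lra].
have be_al t : be t <= al t.
  by have [->|->] := be0_al1 t; [case/andP: (al01 t)|case/andP: (be01 t)].
pose c (x : realization F K * F) w : F := (1 - al x.2) * f x.1 w +
  (al x.2 - be x.2) * g x.1 w + be x.2 * h x.1 w.
have c_ge0 x w : 0 <= c x w.
  have /andP[a0 a1] := al01 x.2; have /andP[b0 b1] := be01 x.2.
  by rewrite !addr_ge0// mulr_ge0 ?subr_ge0 ?bary_ge0.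
have c_supp3 x : [set w | c x w != 0] `<=` [set w | f x.1 w != 0] `|`
    [set w | g x.1 w != 0] `|` [set w | h x.1 w != 0].
  move=> w /=; apply: contra_neqP => /not_orP[/not_orP[/negP + /negP +] /negP].
  by rewrite /c !negbK => /eqP-> /eqP-> /eqP->; rewrite !mulr0 !addr0.
have c_sum x : mass (c x) = 1.
  pose S : set {classic W} := [set w | f x.1 w != 0] `|`
    [set w | g x.1 w != 0] `|` [set w | h x.1 w != 0].
  have finS : finite_set S.
    by rewrite !finite_setU; do !split; exact: finite_bary_support.
  have sumS (b : realization F L) : [set w | b w != 0] `<=` S ->
      \sum_(w <- fset_set S) b w = 1.
    by move=> bS; rewrite -(mass_finite finS)//; exact: bary_sum.
  rewrite (mass_finite finS (c_supp3 x)) !big_split /= -!mulr_sumr !sumS.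
  - by rewrite !mulr1; lra.
  - by move=> w hw; right.
  - by move=> w hw; left; right.
  - by move=> w hw; left; left.
have c_supp x : simplices L [set w | c x w != 0].
  have c0 : [set w | c x w != 0] !=set0.
    apply: contrapT => c0; have /eqP := c_sum x.
    rewrite [mass _]fsbig1 ?[0 == _]eq_sym ?oner_eq0// => w _.
    by apply/eqP; apply: contra_notT c0 => cw; exists w.
  have [b0|a1] := be0_al1 x.2.
    apply: (simplex_sub (fgL x.1)) => // w /=; rewrite /c b0 => cw.
    apply: contrapT => /not_orP[/negP + /negP]; rewrite !negbK => /eqP f0 /eqP g0.
    by move: cw; rewrite f0 g0 !mulr0 mul0r !addr0 eqxx.
  apply: (simplex_sub (ghL x.1)) => // w /=; rewrite /c a1 => cw.
  apply: contrapT => /not_orP[/negP + /negP]; rewrite !negbK => /eqP f0 /eqP g0.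
  by move: cw; rewrite f0 g0 !mulr0 subrr mul0r !addr0 eqxx.
pose H x : realization F L := Realization (c_ge0 x) (c_supp x) (c_sum x).
have bary_inj (a b : realization F L) : bary a = bary b -> a = b.
  case: a b => [a a0 a1 a2] [b b0 b1 b2] /= ab; move: a0 a1 a2; rewrite ab.
  by move=> a0 a1 a2; congr Realization; exact: Prop_irrelevance.
exists H; split.
- apply: continuous_subspaceT; apply: homotopy_trace => s a t Ks sa.
  have fs := simplex_finite Ks.
  have [S1 fS1 sS1] := fF.2 s fs; have [S2 fS2 sS2] := gF.2 s fs.
  have [S3 fS3 sS3] := hF.2 s fs.
  have finS : finite_set (S1 `|` S2 `|` S3) by rewrite !finite_setU.
  have cvg1 (k : realization F K -> realization F L) w :
      continuous_family (fun a => bary (k a)) ->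
      k x.1 w @[x --> filter_prod (trace_nbhs s a) (nbhs t)] --> k a w.
    move=> kF; apply: (@cvg_comp _ _ _ fst (fun b => k b w) _ (trace_nbhs s a)).
      exact: cvg_fst.
    exact: (cvg_trace Ks sa (kF.1 w)).
  have cvg2 (k : F -> F) : continuous k ->
      k x.2 @[x --> filter_prod (trace_nbhs s a) (nbhs t)] --> k t.
    move=> kF; apply: (@cvg_comp _ _ _ snd k _ (nbhs t)); first exact: cvg_snd.
    exact: kF.
  have double : continuous (fun u : F => 2 * u).
    move=> u; apply: (@continuousM F _ (cst 2) id); last exact: cvg_id.
    exact: cst_continuous.
  have alc : continuous al.
    move=> u; apply: (@cvg_comp _ _ _ (fun u => 2 * u) clamp _ (nbhs (2 * u))).
      exact: double.
    exact: continuous_clamp.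
  have bec : continuous be.
    move=> u; apply: (@cvg_comp _ _ _ (fun u => 2 * u - 1) clamp _
      (nbhs (2 * u - 1))); last exact: continuous_clamp.
    apply: (@continuousB F F F _ (cst 1)); first exact: double.
    exact: cst_continuous.
  apply: (cvg_realization _ finS) => [|w].
    exists (closed_simplex s, setT) => /=.
      by split; [exact: trace_nbhs_closed_simplex|exact: filterT].
    move=> [b u] /= [sb _] w /c_supp3 /=.
    by case=> [[?|?]|?]; [left; left; exact: (sS1 b)|left; right; exact: (sS2 b)|
       right; exact: (sS3 b)].
  apply: cvgD; [apply: cvgD|]; apply: cvgM; try exact: cvg1.
  + by apply: cvgB; [exact: cvg_cst|exact: cvg2].
  + by apply: cvgB; exact: cvg2.
  + exact: cvg2.
- move=> a; apply: bary_inj; apply/funext => w /=; rewrite /c /= /al /be.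
  by rewrite !clamp_le0; lra.
- move=> a; apply: bary_inj; apply/funext => w /=; rewrite /c /= /al /be.
  by rewrite !clamp_ge1; lra.
Qed.

End homotopy.

(** * Thresholds on vertices and weights on simplices *)

Section weights.
Variables (F : realType) (X : Type) (D : scomplex X).
Implicit Types (a : realization F D) (x : X) (s : set X).

(** A sum of squares rather than a maximum, so that [continuous_mass] gives continuity; no constant
    threshold would stay below the largest coordinate on simplices of every dimension. *)
Definition level a : F := mass (fun x => a x ^+ 2) / 2.

Definition high a x : F := Num.max 0 (a x - level a).

(** The product forces [s] into the support of [a]; the other factor forces the mass of [a] outside
    [s] below [level a], so that every vertex above the level is in [s]. *)
Definition weight a s : F :=
  if pselect (simplices D s) then
    (\prod_(x <- fset_set (s : set {classic X})) a x) *
    Num.max 0 (level a - mass (fun x => if pselect (s x) then 0 else a x))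
  else 0.

Let continuous_bary x : continuous (fun a => a x).
Proof. exact: (@continuous_family_bary F X D).1. Qed.

Let continuous_family_sqr : continuous_family (fun a x => a x ^+ 2).
Proof.
split=> [x a|S finS]; last first.
  by exists S => // a Sa x /= ax; apply: Sa => /=; rewrite expf_eq0 in ax.
by apply: (@continuousM F _ (fun a => a x) (fun a => a x)); exact: continuous_bary.
Qed.

Lemma continuous_level : continuous level.
Proof.
move=> a; apply: (@continuousM F _ (fun a => mass (fun x => a x ^+ 2)) (cst 2^-1)).
  exact: (continuous_mass continuous_family_sqr).
exact: cst_continuous.
Qed.

Lemma level_gt0 a : 0 < level a.
Proof.
have [x ax] := simplex_neq0 (bary_support a).
rewrite divr_gt0//; apply: (@mass_gt0 _ _ _ x).
- exact: (continuous_family_finite a continuous_family_sqr).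
- by move=> y; rewrite sqr_ge0.
- by rewrite expf_eq0.
Qed.

(** Otherwise the sum of the squares [a x ^+ 2] would be at most [level a] times the sum of the
    [a x], that is [level a], which is half of that positive sum. *)
Lemma level_lt_max a : exists x, level a < a x.
Proof.
apply: contrapT => nex.
have le_level x : a x <= level a.
  by rewrite leNgt; apply/negP => ax; apply: nex; exists x.
have finS := finite_bary_support a.
have e1 : mass (fun x => a x ^+ 2) =
    \sum_(x <- fset_set [set x : {classic X} | a x != 0]) a x ^+ 2.
  by apply: mass_finite => // x; rewrite expf_eq0.
have e2 : 1 = \sum_(x <- fset_set [set x : {classic X} | a x != 0]) a x.
  by rewrite -(bary_sum a); apply: mass_finite.
have : mass (fun x => a x ^+ 2) <= level a * 1.
  rewrite e1 e2 mulr_sumr; apply: ler_sum => x _.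
  by rewrite expr2 ler_wpM2r// bary_ge0.
have := level_gt0 a; rewrite /level; lra.
Qed.

Lemma high_ge0 a x : 0 <= high a x.
Proof. by rewrite /high le_max lexx. Qed.

Lemma high_neq0 a x : (high a x != 0) = (level a < a x).
Proof.
rewrite /high; have [h|h] := ltP (level a) (a x).
  by rewrite max_r ?subr_ge0 ?ltW// subr_eq0 gt_eqF.
by rewrite max_l ?subr_le0// eqxx.
Qed.

Lemma level_lt_neq0 a x : level a < a x -> a x != 0.
Proof. by move=> ax; rewrite gt_eqF// (lt_trans (level_gt0 a)). Qed.

Lemma continuous_family_high : continuous_family high.
Proof.
split=> [x a|S finS].
  apply: (@continuous_max F _ (cst 0) (fun a => a x - level a)).
    exact: cst_continuous.
  apply: (@continuousB F F _ (fun a => a x)); first exact: continuous_bary.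
  exact: continuous_level.
by exists S => // a Sa x /=; rewrite high_neq0 => /level_lt_neq0; exact: Sa.
Qed.

Lemma weight_ge0 a s : 0 <= weight a s.
Proof.
rewrite /weight; case: (pselect (simplices D _)) => //= _; apply: mulr_ge0.
  by apply: prodr_ge0 => x _; exact: bary_ge0.
by rewrite le_max lexx.
Qed.

Let continuous_family_outside s :
  continuous_family (fun a x => if pselect (s x) then 0 else a x).
Proof.
split=> [x|S finS].
  rewrite /=; case: pselect => /= _ a; first exact: cst_continuous.
  exact: continuous_bary.
exists S => // a Sa x /=; case: pselect => /= _; first by rewrite eqxx.
exact: Sa.
Qed.

Lemma weight_neq0 a s : weight a s != 0 ->
  [/\ simplices D s, s `<=` [set x | a x != 0] & forall x, level a < a x -> s x].
Proof.
rewrite /weight; case: (pselect (simplices D _)) => /= [Ds|_]; last by rewrite eqxx.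
rewrite mulf_eq0 negb_or => /andP[ps ms]; split=> // x.
  move=> sx /=; move: ps; apply: contra_neq => ax0.
  apply/eqP; rewrite prodf_seq_eq0; apply/hasP; exists (x : {classic X}).
    by rewrite in_fset_set; [exact: mem_set|exact: simplex_finite Ds].
  by rewrite /= ax0 eqxx.
(* If [x] were outside [s], the mass outside [s] would be at least [a x], hence above the level, and
   the second factor would vanish. *)
move=> ax; apply: contrapT => nsx; move: ms; rewrite max_l ?eqxx// subr_le0.
apply: (le_trans (ltW ax)).
have -> : a x = if pselect (s x) then 0 else a x by case: pselect.
apply: (@le_mass _ _ (fun x => if pselect (s x) then 0 else a x)).
  exact: (continuous_family_finite a (continuous_family_outside s)).
by move=> y; case: pselect => //= _; exact: bary_ge0.
Qed.

(** No mass lies outside the support, so the second factor is [level a]. This keeps the total mass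
    of the homotopy inverse positive before normalization. *)
Lemma weight_support_neq0 a : weight a [set x | a x != 0] != 0.
Proof.
rewrite /weight; case: (pselect (simplices D _)) => /= [_|n]; last first.
  by case: n; exact: bary_support.
rewrite mulf_neq0//.
  rewrite prodf_seq_neq0; apply/allP => x.
  rewrite in_fset_set; last exact: finite_bary_support.
  by move/set_mem.
rewrite [mass _]fsbig1 => [|x _]; last first.
  by case: pselect => //= /negP; rewrite negbK => /eqP.
by rewrite subr0 max_r ?gt_eqF ?ltW ?level_gt0.
Qed.

Lemma continuous_family_weight : continuous_family weight.
Proof.
split=> [s a|S finS].
  rewrite /weight /=; case: (pselect (simplices D s)) => /= _; last first.
    exact: cst_continuous.
  apply: (@continuousM F _
    (fun a => \prod_(x <- fset_set (s : set {classic X})) a x)).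
    apply: continuous_big => [|x _]; first exact: mul_continuous.
    exact: continuous_bary.
  apply: (@continuous_max F _ (cst 0) _); first exact: cst_continuous.
  apply: (@continuousB F F _ level); first exact: continuous_level.
  exact: (continuous_mass (continuous_family_outside s)).
exists [set t | t `<=` S]; first exact: finite_powerset.
by move=> a Sa s /weight_neq0[_ sa _]; exact: subset_trans sa Sa.
Qed.

End weights.

(** * The projection [p] of a complex of rectangles, with [q] the other side *)

Section rectangle_projection.
Variables (F : realType) (V X Y : Type) (K : scomplex V) (D : scomplex X).
Variables (p : smap K D) (q : V -> Y).
Hypothesis pq_inj : forall u v, p u = p v -> q u = q v -> u = v.
Hypothesis simplicesK : forall t, simplices K t <->
  [/\ finite_set t, t !=set0 &
      forall u v, t u -> t v -> exists2 w, p w = p u & q w = q v].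
Hypothesis simplicesD : forall s, simplices D s ->
  exists y, forall x, s x -> exists2 w, p w = x & q w = y.

Let P := realization_map F p.

Let P_neq0 e x : P e x != 0 -> exists2 v, p v = x & e v != 0.
Proof. by rewrite realization_mapE; exact: push_neq0. Qed.

(** The choice of [y(s)]. The values are in [option Y] because sets that are not simplices also need
    one, and [Y] may be empty. *)
Let apex : exists f : set X -> option Y,
  (forall s y x, f s = Some y -> s x -> exists2 w, p w = x & q w = y) /\
  forall s, simplices D s -> exists y, f s = Some y.
Proof.
have /choice[f fP] : forall s, exists o : option Y,
    (forall y x, o = Some y -> s x -> exists2 w, p w = x & q w = y) /\
    (simplices D s -> exists y, o = Some y).
  move=> s; have [/simplicesD[y sy]|nDs] := pselect (simplices D s).
    exists (Some y); split=> [_ x [<-]|_]; [exact: sy|by exists y].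
  by exists None; split.
by exists f; split=> s; have [] := fP s; eauto.
Qed.

Lemma rectangle_projection_homotopy_equivalence : homotopy_equivalence F P.
Proof.
have [apx [apxP apxD]] := apex.
have PF : continuous_family (fun e => bary (P e)).
  exact: continuous_family_realization_map.
split; first exact: continuous_family_continuous.
have weight_fin a := continuous_family_finite a (@continuous_family_weight F X D).
(* The homotopy inverse [g] before normalization; the second factor adds the weights of the
   simplices whose chosen apex is [q v]. *)
pose phi (a : realization F D) v : F :=
  high a (p v) * push apx (weight a) (Some (q v)).
(* Some [s] with apex [q v] has non-zero weight, hence contains every vertex above the level: all of
   them are related to [q v]. *)
have phi_neq0 a v : phi a v != 0 -> level a < a (p v) /\
    forall u, level a < a (p u) -> exists2 w, p w = p u & q w = q v.
  rewrite mulf_eq0 negb_or high_neq0 => /andP[av pv].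
  have [s sv ws] := push_neq0 pv; split=> // u au.
  by have [_ _ /(_ _ au)] := weight_neq0 ws; exact: apxP.
have phiF : continuous_family phi.
  apply: (continuous_family_prod (phi := @high F X D)
    (psi := fun a => push apx (weight a)) (i := p) (j := Some \o q)).
  - by move=> u v puv [quv]; exact: pq_inj.
  - exact: continuous_family_high.
  - exact/continuous_family_push/continuous_family_weight.
have phi_ge0 a v : 0 <= phi a v.
  by rewrite mulr_ge0 ?high_ge0// push_ge0//; exact: weight_ge0.
have phiK a : simplices K [set v | phi a v != 0].
  apply/simplicesK; split; first exact: continuous_family_finite phiF.
    (* Non-emptiness: a vertex [x] above the level is paired with the apex of the whole support of
       [a]. *)
    have [x ax] := level_lt_max a.
    have [y ey] := apxD _ (bary_support a).
    have [w pw qw] := apxP _ _ x ey (level_lt_neq0 ax).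
    exists w; rewrite /= mulf_neq0 ?high_neq0 ?pw// qw -ey.
    by apply: push_image_neq0 => //; [exact: weight_ge0|exact: weight_support_neq0].
  by move=> u v /phi_neq0[au _] /phi_neq0[_]; exact.
have [g gF gsupp] := normalize phiF phi_ge0 phiK.
have g_neq0 a v : (g a v != 0) = (phi a v != 0).
  by have /seteqP[h1 h2] := gsupp a; apply/idP/idP => [/h1|/h2].
(* The intermediate point [h] before normalization. *)
pose psi (e : realization F K) v : F := high (P e) (p v) * push q e (q v).
have psi_neq0 (e : realization F K) v : psi e v != 0 -> level (P e) < P e (p v) /\
    exists2 v', q v' = q v & e v' != 0.
  by rewrite mulf_eq0 negb_or high_neq0 => /andP[ev pv]; have := push_neq0 pv.
have psiF : continuous_family psi.
  apply: (continuous_family_prod (phi := fun e => high (P e))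
    (psi := fun e => push q (bary e)) (i := p) (j := q)) => //.
  - exact: (continuous_family_comp PF (@continuous_family_high F X D)).
  - exact/continuous_family_push/continuous_family_bary.
have psi_ge0 e v : 0 <= psi e v.
  by rewrite mulr_ge0 ?high_ge0// push_ge0//; exact: bary_ge0.
have Krect (e : realization F K) u v :
    e u != 0 -> e v != 0 -> exists2 w, p w = p u & q w = q v.
  move=> eu ev; have /simplicesK[_ _] := bary_support e; exact.
have psiK e : simplices K [set v | psi e v != 0].
  apply/simplicesK; split; first exact: continuous_family_finite psiF.
    have [x ex] := level_lt_max (P e).
    have [v pv ev] := P_neq0 (level_lt_neq0 ex).
    exists v; rewrite /= mulf_neq0 ?high_neq0 ?pv//.
    apply: push_image_neq0 => //; first exact: finite_bary_support.
    exact: bary_ge0.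
  move=> u v /psi_neq0[eu _] /psi_neq0[_ [v' <- ev']].
  by have [u' <- eu'] := P_neq0 (level_lt_neq0 eu); exact: (Krect e).
have [h hF hsupp] := normalize psiF psi_ge0 psiK.
have h_neq0 e v : (h e v != 0) = (psi e v != 0).
  by have /seteqP[h1 h2] := hsupp e; apply/idP/idP => [/h1|/h2].
have simplexU (b c : realization F K) :
    (forall u v, b u != 0 \/ c u != 0 -> b v != 0 \/ c v != 0 ->
      exists2 w, p w = p u & q w = q v) ->
    simplices K ([set v | b v != 0] `|` [set v | c v != 0]).
  move=> bc; apply/simplicesK; split=> //.
    by rewrite finite_setU; split; exact: finite_bary_support.
  by have [v bv] := simplex_neq0 (bary_support b); exists v; left.
exists g; split; first exact: continuous_family_continuous.
- apply: (homotopic_contiguous (g := h)) => //.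
  + exact: (continuous_family_comp PF gF).
  + exact: continuous_family_bary.
  + move=> e; apply: simplexU => u v; rewrite /= !g_neq0 !h_neq0 => eu ev.
    have pu : level (P e) < P e (p u).
      by case: eu => [/phi_neq0[]|/psi_neq0[]].
    (* [q v] is either an apex related to everything above the level, or the [q]-side of a vertex of
       [e]; in the latter case the rectangle condition on the support of [e] applies. *)
    case: ev => [/phi_neq0[_]|/psi_neq0[_ [v' <- ev']]]; first exact.
    by have [u' <- eu'] := P_neq0 (level_lt_neq0 pu); exact: (Krect e).
  + move=> e; apply: simplexU => u v; rewrite /= !h_neq0 => eu ev.
    have [u' <- eu'] : exists2 u', p u' = p u & e u' != 0.
      case: eu => [/psi_neq0[eu _]|eu]; last by exists u.
      exact: P_neq0 (level_lt_neq0 eu).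
    have [v' <- ev'] : exists2 v', q v' = q v & e v' != 0.
      by case: ev => [/psi_neq0[]//|ev]; exists v.
    exact: (Krect e).
- have Pg_supp a : [set x | P (g a) x != 0] `<=` [set x | a x != 0].
    move=> x Px; have [v <-] := P_neq0 Px; rewrite g_neq0 => /phi_neq0[av _].
    exact: level_lt_neq0.
  (* A single segment is enough here: the second one is constant. *)
  apply: (homotopic_contiguous (g := id)).
  + exact: (continuous_family_comp gF PF).
  + exact: continuous_family_bary.
  + exact: continuous_family_bary.
  + move=> a; rewrite (setUidr (Pg_supp a)); exact: bary_support.
  + by move=> a /=; rewrite setUid; exact: bary_support.
Qed.

End rectangle_projection.

(** * Application to both coordinate projections, and naturality *)

Theorem theorem5p1 (F : realType) :
  (forall (X Y : Type) (R : set (X * Y)),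
     homotopy_equivalence F (realization_map F (rect_proj R)) /\
     homotopy_equivalence F (realization_map F (rect_proj_hat R))) /\
  (forall (X0 Y0 X1 Y1 : Type) (R0 : set (X0 * Y0)) (R1 : set (X1 * Y1))
          (f : rel_morphism R0 R1),
     smap_comp (dowker_map f) (rect_proj R0) =
       smap_comp (rect_proj R1) (rectangle_map f) /\
     smap_comp (dowker_map (transpose_morphism f)) (rect_proj_hat R0) =
       smap_comp (rect_proj_hat R1) (rectangle_map f)).
Proof.
split=> [X Y R|X0 Y0 X1 Y1 R0 R1 f]; last first.
  (* The vertex functions of the two composites are convertible; only the proofs that they preserve
     simplices differ. *)
  by split; congr SMap; exact: Prop_irrelevance.
have val_inj2 (u v : R) : rel_fst u = rel_fst v -> rel_snd u = rel_snd v -> u = v.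
  rewrite /rel_fst /rel_snd => e1 e2; apply: val_inj.
  by rewrite [LHS]surjective_pairing [RHS]surjective_pairing e1 e2.
have vertex x y : R (x, y) -> exists w : R, rel_fst w = x /\ rel_snd w = y.
  by move=> /mem_set Rxy; exists (exist _ (x, y) Rxy).
have vertexP (w : R) : R (rel_fst w, rel_snd w).
  by case: w => -[x y] h; exact: (set_mem h).
split.
- apply: (@rectangle_projection_homotopy_equivalence _ _ _ _ _ _ (rect_proj R)
    (@rel_snd _ _ R)) => //.
  + move=> t; split=> [[fint t0 tR]|[fint t0 tR]]; split=> //.
      move=> u v tu tv; have [|w [? ?]] := vertex (rel_fst u) (rel_snd v).
        by apply: tR; split; [exists u|exists v].
      by exists w.
    move=> [_ _] [/= [u tu <-] [v tv <-]].
    have [w wu <-] := tR u v tu tv; have := vertexP w.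
    by rewrite (wu : rel_fst w = rel_fst u).
  + move=> s [_ _ [y sy]]; exists y => x sx.
    by have [|w [? ?]] := vertex x y; [exact: sy|exists w].
- apply: (@rectangle_projection_homotopy_equivalence _ _ _ _ _ _ (rect_proj_hat R)
    (@rel_fst _ _ R)) => //.
  + by move=> u v e1 e2; exact: val_inj2.
  + move=> t; split=> [[fint t0 tR]|[fint t0 tR]]; split=> //.
      (* The roles of the sides are exchanged: [p] is now the second coordinate, so [u] supplies the
         second entry and [v] the first. *)
      move=> u v tu tv; have [|w [? ?]] := vertex (rel_fst v) (rel_snd u).
        by apply: tR; split; [exists v|exists u].
      by exists w.
    move=> [_ _] [/= [u tu <-] [v tv <-]].
    have [w wv <-] := tR v u tv tu; have := vertexP w.
    by rewrite (wv : rel_snd w = rel_snd v).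
  + move=> s [_ _ [x sx]]; exists x => y sy.
    by have [|w [? ?]] := vertex x y; [exact: (sx (y, x))|exists w].
Qed.
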